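(* Let $f:\mathbb{R}^n\to\mathbb{R}\cup\{+\infty\}$ be proper, lower semicontinuous and convex, $A\in\mathbb{R}^{m\times n}$, $b\in\mathbb{R}^m$, and let $(x^*,\lambda^* )\in\Omega$, the set of KKT points of the problem $\min_x f(x)$ s.t. $Ax=b$. Let $\alpha>1$, $\theta\in\mathbb{R}$, let $(\beta_k)_{k\ge1}$ be positive real numbers and $(\epsilon_k)_{k\ge1}\subset\mathbb{R}^n$, and let $\{(x_k,y_k,\lambda_k)\}_{k\ge1}$ be a sequence generated by the fast primal-dual algorithm (described in the context) with these parameters. Assume that there exists an integer $k_1\ge\max\{2,\theta\}$ such that $$\beta_{k+1}=\frac{k(k+\alpha-\theta)}{(k+1)(k+2-\theta)}\,\beta_k\qquad\text{for all } k\ge k_1-1,$$ and that $$\sum_{k=1}^{+\infty}k\|\epsilon_k\|<+\infty,\qquad \lim_{k\to+\infty}k^2\beta_k=+\infty.$$ Then, as $k\to+\infty$, $$\|Ax_k-b\|=\mathcal{O}\left(\frac{1}{k^{\alpha-1}}\right),\qquad |f(x_k)-f(x^* )|=\mathcal{O}\left(\frac{1}{k^{\alpha-1}}\right).$$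
   Context: $\|\cdot\|$ is the Euclidean norm and $\partial f(x)=\{v\in\mathbb{R}^n: f(y)\ge f(x)+\langle v,y-x\rangle\ \forall y\in\mathbb{R}^n\}$. The KKT set $\Omega$ consists of all $(x^*,\lambda^* )\in\mathbb{R}^n\times\mathbb{R}^m$ with $-A^T\lambda^*\in\partial f(x^* )$ and $Ax^*=b$ (assumed nonempty). Fast primal-dual algorithm. Choose $x_0\in\mathbb{R}^n$, $\lambda_0\in\mathbb{R}^m$; set $x_1=x_0$, $\lambda_1=\lambda_0$ (and $y_1=x_1$). For $k=1,2,\dots$: Step 1: $\bar x_k=x_k+\frac{k-\theta}{k+\alpha-\theta}(x_k-x_{k-1})$. Step 2: with $\vartheta_k=\frac{k(k+\alpha-\theta)\beta_k}{\alpha-1}$ and $\eta_k=\frac{k+1-\theta}{k+\alpha-\theta}Ax_k+\frac{\alpha-1}{k+\alpha-\theta}b$, let $x_{k+1}$ be a minimizer over $x\in\mathbb{R}^n$ of $$f(x)+\frac{k+\alpha-\theta}{2k\beta_k}\|x-\bar x_k\|^2+\frac{\vartheta_k}{2}\|Ax-\eta_k\|^2+\Big\langle A^T\lambda_k-\frac{\epsilon_k}{\beta_k},x\Big\rangle .$$ Step 3: $y_{k+1}=x_{k+1}+\frac{k+1-\theta}{\alpha-1}(x_{k+1}-x_k)$ and $\lambda_{k+1}=\lambda_k+k\beta_k(Ay_{k+1}-b)$. The algorithm is run without stopping, and ''a sequence generated by the algorithm'' means an infinite sequence for which all these steps are well defined (in particular $k+\alpha-\theta\neq0$ for all $k\ge1$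 and the minimizers exist). *)

(* Defs.v *)
From HB Require Import structures.
From mathcomp Require Import all_boot all_order all_algebra.
From mathcomp Require Import all_classical all_reals all_analysis.

Set Implicit Arguments.
Unset Strict Implicit.
Unset Printing Implicit Defensive.

Import Order.TTheory GRing.Theory Num.Theory.
Import numFieldNormedType.Exports.

Local Open Scope classical_set_scope.
Local Open Scope ring_scope.

Definition dot (R : realType) (n : nat) (u v : 'cV[R]_n) : R :=
  \sum_(i < n) u i 0 * v i 0.

(* The library norm on matrices is the sup norm; this is the Euclidean one. *)
Definition enorm (R : realType) (n : nat) (u : 'cV[R]_n) : R :=
  Num.sqrt (dot u u).

Definition proper_fun (R : realType) (n : nat) (f : 'cV[R]_n -> \bar R) : Prop :=
  (forall x, f x != -oo%E) /\ (exists x, f x != +oo%E).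

(* At t = 0 or t = 1 the product 0 * +oo is 0, so the inequality is trivial. *)
Definition convex_efun (R : realType) (n : nat) (f : 'cV[R]_n -> \bar R) : Prop :=
  forall (x y : 'cV[R]_n) (t : R), 0 <= t <= 1 ->
    (f (t *: x + (1 - t) *: y)%R <= t%:E * f x + (1 - t)%:E * f y)%E.

Definition subdiff (R : realType) (n : nat) (f : 'cV[R]_n -> \bar R)
    (x : 'cV[R]_n) : set 'cV[R]_n :=
  [set v | forall y, (f x + (dot v (y - x)%R)%:E <= f y)%E].

Definition KKT (R : realType) (m n : nat) (f : 'cV[R]_n -> \bar R)
    (A : 'M[R]_(m, n)) (b : 'cV[R]_m) : set ('cV[R]_n * 'cV[R]_m) :=
  [set p | subdiff f p.1 (- (A^T *m p.2)) /\ A *m p.1 = b].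

Definition is_minimizer (T : Type) (R : realType) (g : T -> \bar R) (x : T) :
  Prop := forall z, (g x <= g z)%E.

Section FastPrimalDual.
Variables (R : realType) (m n : nat).
Variables (f : 'cV[R]_n -> \bar R) (A : 'M[R]_(m, n)) (b : 'cV[R]_m).
Variables (alpha theta : R) (beta : nat -> R) (eps : nat -> 'cV[R]_n).

Definition extrapolation (x : nat -> 'cV[R]_n) (k : nat) : 'cV[R]_n :=
  x k + ((k%:R - theta) / (k%:R + alpha - theta)) *: (x k - x k.-1).

Definition vartheta (k : nat) : R :=
  k%:R * (k%:R + alpha - theta) * beta k / (alpha - 1).

Definition eta (x : nat -> 'cV[R]_n) (k : nat) : 'cV[R]_m :=
  ((k%:R + 1 - theta) / (k%:R + alpha - theta)) *: (A *m x k)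
  + ((alpha - 1) / (k%:R + alpha - theta)) *: b.

Definition step_objective (x : nat -> 'cV[R]_n) (lambda : nat -> 'cV[R]_m)
    (k : nat) (z : 'cV[R]_n) : \bar R :=
  (f z + ((k%:R + alpha - theta) / (2 * k%:R * beta k)
            * enorm (z - extrapolation x k) ^+ 2
          + vartheta k / 2 * enorm (A *m z - eta x k) ^+ 2
          + dot (A^T *m lambda k - (beta k)^-1 *: eps k) z)%:E)%E.

(* Only the values x k, lambda k for k >= 0 and y k, beta k, eps k for k >= 1
   matter.  Nonvanishing of the denominators is part of well-definedness, since
   division by 0 is total here. *)
Record fast_primal_dual (x y : nat -> 'cV[R]_n) (lambda : nat -> 'cV[R]_m) :
    Prop := FastPrimalDual {
  fpd_x1 : x 1%N = x 0%N;
  fpd_lambda1 : lambda 1%N = lambda 0%N;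
  fpd_y1 : y 1%N = x 1%N;
  fpd_denom : forall k, (1 <= k)%N -> k%:R + alpha - theta != 0;
  fpd_x : forall k, (1 <= k)%N ->
    is_minimizer (step_objective x lambda k) (x k.+1);
  fpd_y : forall k, (1 <= k)%N ->
    y k.+1 = x k.+1 + ((k%:R + 1 - theta) / (alpha - 1)) *: (x k.+1 - x k);
  fpd_lambda : forall k, (1 <= k)%N ->
    lambda k.+1 = lambda k + (k%:R * beta k) *: (A *m y k.+1 - b)
}.

End FastPrimalDual.

(* Main.v *)
(** With p = alpha - 1, weights w_k = k (k + 1 - theta) beta_k and Lagrangian gap
    L_k = f(x_k) - f(xs) + <lambdas, A x_k - b> >= 0, the optimality condition of Step 2 reads
      - p/(k beta_k) (y_(k+1) - y_k) - A^T lambda_(k+1) + eps_k/beta_k in the subdifferential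
    of f at x_(k+1).  The rule for beta says w_(k+1) = k (k + alpha - theta) beta_k, which makes
      E_k = w_k L_k + p^2/2 |y_k - xs|^2 + p/2 |lambda_k - lambdas|^2
    satisfy E_(k+1) <= E_k + p k |eps_k| |y_(k+1) - xs|; since k |eps_k| is summable, E is bounded.
    Hence L_k = O(1/w_k).  Moreover w_k (A x_k - b) - p lambda_k is constant, so boundedness of
    lambda gives |A x_k - b| = O(1/w_k), and |f(x_k) - f(xs)| = O(1/w_k) follows.  Finally
    w_(k+1)/w_k = 1 + p/(k + 1 - theta) forces w_k to grow at least like k^p. *)
Require Import Defs.
From HB Require Import structures.
From mathcomp Require Import all_boot all_order all_algebra.
From mathcomp Require Import all_classical all_reals all_analysis.
From mathcomp Require Import ring lra.
Import Order.TTheory GRing.Theory Num.Theory.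
Import numFieldNormedType.Exports.
Local Open Scope classical_set_scope.
Local Open Scope ring_scope.

(** * Euclidean inner product and norm on column vectors *)

Section EuclideanSpace.
Context {R : realType}.
Implicit Types n m : nat.

Lemma dotC {n} (u v : 'cV[R]_n) : dot u v = dot v u.
Proof. by apply: eq_bigr => i _; rewrite mulrC. Qed.

Lemma dotDl {n} (u v w : 'cV[R]_n) : dot (u + v) w = dot u w + dot v w.
Proof. by rewrite -big_split; apply: eq_bigr => i _; rewrite mxE mulrDl. Qed.

Lemma dotZl {n} (a : R) (u w : 'cV[R]_n) : dot (a *: u) w = a * dot u w.
Proof. by rewrite mulr_sumr; apply: eq_bigr => i _; rewrite mxE mulrA. Qed.

Lemma dotNl {n} (u w : 'cV[R]_n) : dot (- u) w = - dot u w.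
Proof. by rewrite -scaleN1r dotZl mulN1r. Qed.

Lemma dotDr {n} (u v w : 'cV[R]_n) : dot w (u + v) = dot w u + dot w v.
Proof. by rewrite dotC dotDl !(dotC w). Qed.

Lemma dotZr {n} (a : R) (u w : 'cV[R]_n) : dot w (a *: u) = a * dot w u.
Proof. by rewrite dotC dotZl dotC. Qed.

Lemma dotNr {n} (u w : 'cV[R]_n) : dot w (- u) = - dot w u.
Proof. by rewrite dotC dotNl dotC. Qed.

Definition dot_linear {n} := (@dotDl n, @dotDr n, @dotNl n, @dotNr n, @dotZl n, @dotZr n).

Lemma dot_trmx {m n} (A : 'M[R]_(m, n)) (u : 'cV[R]_m) (v : 'cV[R]_n) :
  dot (A^T *m u) v = dot u (A *m v).
Proof.
transitivity (\sum_i \sum_j A j i * u j 0 * v i 0).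
  apply: eq_bigr => i _; rewrite mxE mulr_suml.
  by apply: eq_bigr => j _; rewrite mxE.
rewrite exchange_big; apply: eq_bigr => j _; rewrite mxE mulr_sumr.
by apply: eq_bigr => i _; rewrite mulrCA mulrA.
Qed.

Lemma dot_ge0 {n} (u : 'cV[R]_n) : 0 <= dot u u.
Proof. by apply: sumr_ge0 => i _; rewrite -expr2 sqr_ge0. Qed.

Lemma dot_eq0 {n} (u : 'cV[R]_n) : dot u u = 0 -> u = 0.
Proof.
move=> /eqP; rewrite psumr_eq0 => [/allP u0|i _]; last by rewrite -expr2 sqr_ge0.
apply/colP => i; rewrite mxE; apply/eqP.
by have := u0 i (mem_index_enum i); rewrite -expr2 sqrf_eq0.
Qed.

Lemma enorm_ge0 {n} (u : 'cV[R]_n) : 0 <= enorm u.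
Proof. exact: sqrtr_ge0. Qed.

Lemma sqr_enorm {n} (u : 'cV[R]_n) : enorm u ^+ 2 = dot u u.
Proof. by rewrite sqr_sqrtr ?dot_ge0. Qed.

Lemma enorm_le {n} (u : 'cV[R]_n) (a : R) : 0 <= a -> dot u u <= a ^+ 2 -> enorm u <= a.
Proof. by move=> a0 h; rewrite -[a]ger0_norm// -sqrtr_sqr ler_wsqrtr. Qed.

Lemma cauchy_schwarz {n} (u v : 'cV[R]_n) : `|dot u v| <= enorm u * enorm v.
Proof.
rewrite /enorm -sqrtrM ?dot_ge0// -sqrtr_sqr ler_wsqrtr//.
have [v0|vN0] := eqVneq (dot v v) 0.
  by rewrite (dot_eq0 _ v0) -(scale0r v) !dotZr !mul0r mulr0 expr0n.
have v_gt0 : 0 < dot v v by rewrite lt_def vN0 dot_ge0.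
(* This square expands to [dot v v] times the difference of the two sides, so the positive factor
   divides out. *)
have := dot_ge0 (dot v v *: u - dot u v *: v).
rewrite !dot_linear (dotC v u) => h.
rewrite -(ler_pM2l v_gt0); lra.
Qed.

Lemma enormD {n} (u v : 'cV[R]_n) : enorm (u + v) <= enorm u + enorm v.
Proof.
apply: enorm_le; first by rewrite addr_ge0 ?enorm_ge0.
have := ler_norm (dot u v); have := cauchy_schwarz u v.
rewrite !dot_linear sqrrD !sqr_enorm (dotC v u); lra.
Qed.

Lemma enormZ {n} (a : R) (u : 'cV[R]_n) : enorm (a *: u) = `|a| * enorm u.
Proof. by rewrite /enorm !dot_linear mulrA -expr2 sqrtrM ?sqr_ge0// sqrtr_sqr. Qed.

End EuclideanSpace.

(** * Subgradients of extended-valued functions and Fermat's rule *)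

Section ConvexMinimization.
Context {R : realType} {n : nat}.
Implicit Types f : 'cV[R]_n -> \bar R.

Lemma minimizer_fin_num f (g : 'cV[R]_n -> R) x : proper_fun f ->
  is_minimizer (fun z => f z + (g z)%:E)%E x -> f x \is a fin_num.
Proof.
move=> [fN [z fz]] /(_ z) h; rewrite fin_numE fN /=.
apply/eqP => fx; move: h fz (fN z); rewrite fx.
by case: (f z).
Qed.

Lemma subdiff_fin_num f x v : proper_fun f -> subdiff f x v -> f x \is a fin_num.
Proof.
move=> [fN [z fz]] /(_ z) h; rewrite fin_numE fN /=.
apply/eqP => fx; move: h fz (fN z); rewrite fx.
by case: (f z).
Qed.

Lemma subdiff_fine f x v z : subdiff f x v -> f x \is a fin_num -> f z \is a fin_num ->
  fine (f x) + dot v (z - x) <= fine (f z).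
Proof.
move=> /(_ z) h fx fz; move: h.
by rewrite -{1}(fineK fx) -{1}(fineK fz) -EFinD lee_fin.
Qed.

(* Fermat's rule: moving from [x] towards [z] by a step [t], convexity bounds
   the loss of [f] by [t * (f z - f x)], so the quadratic term is negligible. *)
Lemma minimizer_subdiff f (g q : 'cV[R]_n -> R) x v : proper_fun f -> convex_efun f ->
  (forall d (t : R), g (x + t *: d) = g x + t * dot v d + t ^+ 2 * q d) ->
  is_minimizer (fun z => f z + (g z)%:E)%E x -> subdiff f x (- v).
Proof.
move=> fP fC gE xmin z.
have fx := minimizer_fin_num _ _ _ fP xmin.
case fzE : (f z) => [fz| |]; last 2 first.
- by rewrite leey.
- by have := fP.1 z; rewrite fzE.
rewrite -(fineK fx) -EFinD lee_fin dotNl.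
set a := fine (f x); set d := z - x.
have step t : 0 < t <= 1 -> a - fz - dot v d <= t * q d.
  move=> /andP[t0 t1].
  have := xmin (t *: z + (1 - t) *: x).
  have -> : t *: z + (1 - t) *: x = x + t *: d.
    by apply/colP => i; rewrite !mxE; ring.
  have := fC z x t; rewrite (ltW t0) t1 => /(_ isT).
  have -> : t *: z + (1 - t) *: x = x + t *: d.
    by apply/colP => i; rewrite !mxE; ring.
  rewrite fzE -(fineK fx) -/a gE -!EFinM -EFinD.
  case: (f (x + t *: d)) => [w| |] //; rewrite -!EFinD !lee_fin => h1 h2.
  rewrite -(ler_pM2l t0); lra.
apply: contrapT => /negP; rewrite -ltNge => h.
set e := a - fz - dot v d; have e0 : 0 < e by rewrite /e; lra.
(* The step [t = e / D] lies in (0, 1], and [t * q d < e] because [q d < D]; this contradicts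
   [step]. *)
pose D := e + 1 + `|q d|.
have D0 : 0 < D by rewrite /D; have := normr_ge0 (q d); lra.
have t01 : 0 < e / D <= 1.
  by rewrite divr_gt0//= ler_pdivrMr// /D; have := normr_ge0 (q d); lra.
have := step _ t01; rewrite -/e mulrAC ler_pdivlMr// ler_pM2l// /D.
have := ler_norm (q d); lra.
Qed.

End ConvexMinimization.

(** * Perturbed recurrences, power growth and big-O bounds for real sequences *)

Section RealSequences.
Context {R : realType}.

(* Divide [e_(k+1)^2 - e_k^2 <= d_k e_(k+1) <= d_k (e_(k+1) + e_k)] by [e_(k+1) + e_k],
   for [e = sqrt E]. *)
Lemma sqrt_recurrence_bounded (E d : nat -> R) (K : nat) (S : R) :
  (forall k, (K <= k)%N -> 0 <= E k) -> (forall k, (K <= k)%N -> 0 <= d k) ->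
  (forall k, (K <= k)%N -> E k.+1 <= E k + d k * Num.sqrt (E k.+1)) ->
  (forall k, (K <= k)%N -> \sum_(K <= i < k) d i <= S) ->
  forall k, (K <= k)%N -> E k <= (Num.sqrt (E K) + S) ^+ 2.
Proof.
move=> E0 d0 EE dS.
have le_sum k : (K <= k)%N -> Num.sqrt (E k) <= Num.sqrt (E K) + \sum_(K <= i < k) d i.
  elim: k => [|k IH]; first by rewrite leqn0 => /eqP ->; rewrite big_nil addr0.
  rewrite leq_eqVlt => /predU1P[<-|]; first by rewrite big_geq// addr0.
  rewrite ltnS => Kk; have {}IH := IH Kk.
  rewrite big_nat_recr//= addrA; apply: le_trans (lerD IH (lexx _)).
  have := EE k Kk; have := d0 k Kk.
  have := E0 k Kk; have := E0 k.+1 (leqW Kk).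
  move=> /sqr_sqrtr; move: (Num.sqrt (E k.+1)) (sqrtr_ge0 (E k.+1)) => a a0 <-.
  move=> /sqr_sqrtr; move: (Num.sqrt (E k)) (sqrtr_ge0 (E k)) => b b0 <- dk0 h.
  rewrite leNgt; apply/negP => lt_a; nra.
move=> k Kk; rewrite -(sqr_sqrtr (E0 k Kk)) lerXn2r ?nnegrE ?sqrtr_ge0//.
  by rewrite addr_ge0 ?sqrtr_ge0// (le_trans _ (dS K (leqnn K)))// big_geq.
by rewrite (le_trans (le_sum k Kk))// lerD2l dS.
Qed.

(* [(1 + 1/a)^p <= exp (p/a) <= 1/(1 - p/a)], as [1 - p/a <= exp (-p/a)]. *)
Lemma powR_succ_ratio (a p : R) : 0 < p -> p < a ->
  (a + 1) `^ p <= a / (a - p) * a `^ p.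
Proof.
move=> p0 pa; have a0 : 0 < a by exact: lt_trans pa.
have -> : a + 1 = (1 + a^-1) * a by field; rewrite gt_eqF.
rewrite powRM ?addr_ge0 ?invr_ge0 ?(ltW a0)// ler_wpM2r ?powR_ge0//.
apply: (@le_trans _ _ (expR (p / a))).
  rewrite mulrC expRM ge0_ler_powR ?nnegrE ?expR_ge0 ?(ltW p0)//.
    by rewrite addr_ge0 ?invr_ge0 ?(ltW a0).
  exact: expR_ge1Dx.
have := expR_ge1Dx (- (p / a)); rewrite expRN => h.
have e0 := expR_gt0 (p / a).
rewrite ler_pdivlMr ?subr_gt0//.
have -> : expR (p / a) * (a - p) = (1 - p / a) * (expR (p / a) * a).
  by field; rewrite gt_eqF.
apply: (le_trans (ler_wpM2r _ h)); first by rewrite mulr_ge0// ltW.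
by rewrite mulrA mulVf ?mul1r// gt_eqF.
Qed.

(** By [powR_succ_ratio], the shifted power [(k + a)^p] grows at each step by at most the ratio of
    [s]. Equality at [K] fixes the constant, and induction keeps [s] above. *)
Lemma powR_growth (s : nat -> R) (a p : R) (K : nat) : 0 < p -> 0 < K%:R + a - p ->
  0 < s K ->
  (forall k, (K <= k)%N -> s k.+1 = (k%:R + a) / (k%:R + a - p) * s k) ->
  exists2 c, 0 < c & \forall k \near \oo, c * k%:R `^ p <= s k.
Proof.
move=> p0 Ka sK sE.
have kK k : (K <= k)%N -> K%:R <= k%:R :> R by rewrite ler_nat.
have q0 k : (K <= k)%N -> 0 < k%:R + a :> R by move=> /kK; lra.
pose c := s K / (K%:R + a) `^ p.
have c0 : 0 < c by rewrite divr_gt0// powR_gt0// q0.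
have cK : c * (K%:R + a) `^ p = s K by rewrite /c divfK// gt_eqF// powR_gt0// q0.
have cs k : (K <= k)%N -> c * (k%:R + a) `^ p <= s k.
  elim: k => [|k IH].
    by rewrite leqn0 => /eqP <-; rewrite cK.
  rewrite leq_eqVlt => /predU1P[<-|]; first by rewrite cK.
  rewrite ltnS => Kk; rewrite sE//.
  have kap : 0 < k%:R + a - p by have := kK _ Kk; lra.
  have -> : k.+1%:R + a = k%:R + a + 1 :> R by rewrite -natr1; ring.
  have := powR_succ_ratio (k%:R + a) p p0; rewrite -subr_gt0 => /(_ kap) h.
  apply: (le_trans (ler_wpM2l (ltW c0) h)).
  by rewrite mulrCA ler_wpM2l ?IH// divr_ge0// ltW// q0.
(* The factor [2^-p] pays for replacing [k + a] by [k / 2], which is smaller once [k > 2 |a|]. *)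
exists (c * (2^-1) `^ p); first by rewrite mulr_gt0// powR_gt0// invr_gt0.
near=> k.
apply: le_trans (cs k _); last by near: k; exact: nbhs_infty_ge.
rewrite -mulrA -powRM ?invr_ge0// ler_pM2l//.
have k2 : 2 * `|a| < k%:R by near: k; exact: nbhs_infty_gtr.
have := normr_ge0 a; have := ler_norm (- a); rewrite normrN => ? ?.
by rewrite ge0_ler_powR ?nnegrE ?(ltW p0)//; lra.
Unshelve. all: by end_near.
Qed.

Lemma nneseries_partial_bounded (u : nat -> R) : (forall k, 0 <= u k) ->
  (\sum_(1 <= k <oo) (u k)%:E < +oo)%E ->
  exists S, forall K k, (1 <= K)%N -> \sum_(K <= i < k) u i <= S.
Proof.
move=> u0; set s := (\sum_(1 <= k <oo) (u k)%:E)%E => s_fin.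
have s0 : (0 <= s)%E by apply: nneseries_ge0 => k _ _; rewrite lee_fin.
have sE : s = (fine s)%:E by rewrite fineK// ge0_fin_numE.
exists (fine s) => K k K1; apply: (@le_trans _ _ (\sum_(1 <= i < k) u i)).
  have [kK|Kk] := leqP k K; first by rewrite big_geq// sumr_ge0.
  by rewrite (big_cat_nat K1 (ltnW Kk))/= lerDr sumr_ge0.
rewrite -lee_fin -sumEFin -sE.
by apply: nneseries_lim_ge => i _ _; rewrite lee_fin.
Qed.

Lemma eqO_inv_powR {V : normedModType R} (u : nat -> V) (s : nat -> R) (p c C : R) (K : nat) :
  0 < c -> 0 <= C -> (\forall k \near \oo, c * k%:R `^ p <= s k) ->
  (forall k, (K <= k)%N -> s k * `|u k| <= C) ->
  u =O_\oo (fun k : nat => 1 / (k%:R `^ p) : R).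
Proof.
move=> c0 C0 cs su; apply/eqO_exP.
(* The big-O constant must be positive while [C] may vanish, hence [C + 1]. *)
exists ((C + 1) / c); first by rewrite divr_gt0// ltr_wpDl.
near=> k.
have k0 : 0 < k%:R `^ p :> R.
  by apply: powR_gt0; rewrite ltr0n; near: k; exact: nbhs_infty_ge.
have csk : c * k%:R `^ p <= s k by near: k.
have Kk : (K <= k)%N by near: k; exact: nbhs_infty_ge.
rewrite ger0_norm ?divr_ge0 ?powR_ge0// mul1r -mulrA -invfM ler_pdivlMr ?mulr_gt0//.
rewrite mulrC; apply: (le_trans (ler_wpM2r (normr_ge0 _) csk)).
by apply: (le_trans (su k Kk)); rewrite lerDl.
Unshelve. all: by end_near.
Qed.

End RealSequences.

(** Brings the smooth part of the Step 2 objective to the form required by [minimizer_subdiff]: the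
    factor of [t] is the gradient at [z] paired with [d]. *)
Lemma quadratic_expansion {R : realType} {m n : nat} (A : 'M[R]_(m, n)) (a1 a2 : R)
    (u w : 'cV[R]_n) (v : 'cV[R]_m) (z d : 'cV[R]_n) (t : R) :
  let g z := a1 * enorm (z - u) ^+ 2 + a2 * enorm (A *m z - v) ^+ 2 + dot w z in
  g (z + t *: d) = g z
    + t * dot ((2 * a1) *: (z - u) + (2 * a2) *: (A^T *m (A *m z - v)) + w) d
    + t ^+ 2 * (a1 * dot d d + a2 * dot (A *m d) (A *m d)).
Proof.
move=> g; rewrite {}/g !sqr_enorm (mulmxDr _ z) -scalemxAr.
have -> : z + t *: d - u = z - u + t *: d by rewrite addrAC.
have -> : A *m z + t *: (A *m d) - v = A *m z - v + t *: (A *m d) by rewrite addrAC.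
move: (z - u) (A *m z - v) => p q.
rewrite !dot_linear dot_trmx (dotC d p) (dotC (A *m d) q); ring.
Qed.

(** * Identities and optimality condition of one iteration *)

Section Iteration.
Context {R : realType} {m n : nat} {f : 'cV[R]_n -> \bar R} {A : 'M[R]_(m, n)} {b : 'cV[R]_m}.
Context {alpha theta : R} {beta : nat -> R} {eps : nat -> 'cV[R]_n}.
Context {x y : nat -> 'cV[R]_n} {lambda : nat -> 'cV[R]_m}.
Hypothesis halg : fast_primal_dual f A b alpha theta beta eps x y lambda.
Hypotheses (f_proper : proper_fun f) (f_convex : convex_efun f).
Hypotheses (alpha_gt1 : 1 < alpha) (beta_gt0 : forall k, (1 <= k)%N -> 0 < beta k).

Let alphaN0 : alpha - 1 != 0.
Proof. by rewrite subr_eq0 gt_eqF. Qed.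

Let betaN0 k : (1 <= k)%N -> beta k != 0.
Proof. by move=> /beta_gt0 /lt0r_neq0. Qed.

Let natN0 k : (1 <= k)%N -> k%:R != 0 :> R.
Proof. by rewrite pnatr_eq0 lt0n. Qed.

(** Step 3 covers [k >= 2]; at [k = 1] the initialization makes the increment of [x] vanish. *)
Lemma fpd_y_extrapolation k : (1 <= k)%N ->
  y k = x k + ((k%:R - theta) / (alpha - 1)) *: (x k - x k.-1).
Proof.
case: k => [//|[_|k _]]; first by rewrite (fpd_y1 halg) (fpd_x1 halg) subrr scaler0 addr0.
by rewrite (fpd_y halg)//= [in RHS]mulrS [in RHS](addrC 1).
Qed.

(** Turns the gradient of the proximal term into an increment of [y], which the energy can
    telescope. *)
Lemma fpd_x_sub_extrapolation k : (1 <= k)%N ->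
  (k%:R + alpha - theta) *: (x k.+1 - extrapolation alpha theta x k)
  = (alpha - 1) *: (y k.+1 - y k).
Proof.
move=> k1; rewrite (fpd_y_extrapolation k k1) (fpd_y halg)// /extrapolation.
apply/colP => i; rewrite !mxE; field.
by rewrite alphaN0 (fpd_denom halg).
Qed.

Lemma fpd_residual_y k : (1 <= k)%N ->
  (alpha - 1) *: (A *m y k.+1 - b)
  = (k%:R + alpha - theta) *: (A *m x k.+1 - b) - (k%:R + 1 - theta) *: (A *m x k - b).
Proof.
move=> k1; rewrite (fpd_y halg)// mulmxDr -scalemxAr mulmxBr.
move: (A *m x k.+1) (A *m x k) => u v.
by apply/colP => i; rewrite !mxE; field.
Qed.

Lemma fpd_x_sub_eta k : (1 <= k)%N ->
  (k%:R + alpha - theta) *: (A *m x k.+1 - Defs.eta A b alpha theta x k)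
  = (alpha - 1) *: (A *m y k.+1 - b).
Proof.
move=> k1; rewrite fpd_residual_y// /Defs.eta.
move: (A *m x k.+1) (A *m x k) => u v.
apply/colP => i; rewrite !mxE; field.
exact: (fpd_denom halg).
Qed.

(** Fermat's rule for Step 2. The penalty gradient equals [k beta_k A^T (A y_(k+1) - b)], exactly
    the increment of [A^T lambda], so the updated multiplier appears. *)
Lemma fpd_subdiff k : (1 <= k)%N ->
  subdiff f (x k.+1) (- (((alpha - 1) / (k%:R * beta k)) *: (y k.+1 - y k)
                         + A^T *m lambda k.+1 - (beta k)^-1 *: eps k)).
Proof.
move=> k1; have c0 := fpd_denom halg k1; have k0 := natN0 k k1; have b0 := betaN0 k k1.
set v := (X in - X).
apply: (minimizer_subdiff f _ _ _ v f_proper f_convex) (fpd_x halg k1) => d t.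
rewrite quadratic_expansion; congr (_ + t * dot _ d + _); rewrite /v.
have -> : 2 * ((k%:R + alpha - theta) / (2 * k%:R * beta k))
    = (k%:R * beta k)^-1 * (k%:R + alpha - theta) by field; rewrite k0 b0.
have -> : 2 * (vartheta alpha theta beta k / 2)
    = k%:R * beta k / (alpha - 1) * (k%:R + alpha - theta).
  by rewrite /vartheta; field.
rewrite -!(scalerA _ (k%:R + alpha - theta)) fpd_x_sub_extrapolation//.
rewrite scalemxAr fpd_x_sub_eta// -scalemxAr !scalerA divfK// (mulrC _^-1) -!addrA; congr (_ + _).
by rewrite !addrA (fpd_lambda halg)// (mulmxDr _ (lambda k)) -scalemxAr (addrC (A^T *m lambda k)).
Qed.

(** The index starts at 2 because [x 1 = x 0] is arbitrary and may lie outside the domain of [f];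
    later iterates are minimizers. *)
Lemma fpd_fin_num k : (2 <= k)%N -> f (x k) \is a fin_num.
Proof.
case: k => [//|k k1].
by apply: (minimizer_fin_num f _ _ f_proper) (fpd_x halg k1).
Qed.

(** * Lagrangian gap and one-step decrease of the energy *)

Section Energy.
Context {xs : 'cV[R]_n} {lambdas : 'cV[R]_m}.
Hypothesis hKKT : KKT f A b (xs, lambdas).

Let Axs : A *m xs = b := hKKT.2.

(** Since [fine] sends infinite values to 0, this is the Lagrangian gap only where [f (x k)] is
    finite. *)
Definition gap (k : nat) : R := fine (f (x k)) - fine (f xs) + dot lambdas (A *m x k - b).

Definition weight (k : nat) : R := k%:R * (k%:R + 1 - theta) * beta k.

Definition energy (k : nat) : R :=
  weight k * gap k + (alpha - 1) ^+ 2 / 2 * dot (y k - xs) (y k - xs)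
  + (alpha - 1) / 2 * dot (lambda k - lambdas) (lambda k - lambdas).

Let fxs : f xs \is a fin_num.
Proof. exact: subdiff_fin_num f_proper hKKT.1. Qed.

(** This is the subgradient inequality for [- A^T lambdas] at [xs], with [A xs = b]. *)
Lemma gap_ge0 k : (2 <= k)%N -> 0 <= gap k.
Proof.
move=> k2; have := subdiff_fine _ _ _ _ hKKT.1 fxs (fpd_fin_num k k2).
rewrite /gap /= dotNl dot_trmx mulmxBr Axs; lra.
Qed.

(* The subgradient inequality at [x (k+1)], tested against [x k] and against [xs]
   with weights [k + 1 - theta] and [alpha - 1]. *)
Lemma gap_step k : (2 <= k)%N -> 0 <= k%:R + 1 - theta ->
  k%:R * beta k * ((k%:R + alpha - theta) * gap k.+1 - (k%:R + 1 - theta) * gap k)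
  <= (alpha - 1) * (k%:R * dot (eps k) (y k.+1 - xs)
       - (alpha - 1) * dot (y k.+1 - y k) (y k.+1 - xs)
       - dot (lambda k.+1 - lambdas) (lambda k.+1 - lambda k)).
Proof.
move=> k2 kt; have k1 : (1 <= k)%N by exact: ltnW.
have k0 : 0 < k%:R :> R by rewrite ltr0n.
have b0 := beta_gt0 k k1.
have fk := fpd_fin_num k k2; have fk1 := fpd_fin_num k.+1 (leqW k2).
have sub := fpd_subdiff k k1.
set v := (- (_ + _ - _)) in sub.
have hx := subdiff_fine _ _ _ _ sub fk1 fk.
have hs := subdiff_fine _ _ _ _ sub fk1 fxs.
(* Step 3 combines the two displacements with exactly the chosen weights, so the weighted sum of
   [hx] and [hs] sees [v] only through [y k.+1 - xs]. *)
have yE : (alpha - 1) *: (y k.+1 - xs)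
    = - ((k%:R + 1 - theta) *: (x k - x k.+1) + (alpha - 1) *: (xs - x k.+1)).
  by rewrite (fpd_y halg)//; apply/colP => i; rewrite !mxE; field.
have dv : (alpha - 1) * dot v (y k.+1 - xs)
    = - ((k%:R + 1 - theta) * dot v (x k - x k.+1) + (alpha - 1) * dot v (xs - x k.+1)).
  by rewrite -[LHS]dotZr yE dotNr [in LHS]dotDr !dotZr.
have res : (k%:R + alpha - theta) * dot lambdas (A *m x k.+1 - b)
    - (k%:R + 1 - theta) * dot lambdas (A *m x k - b)
    = (alpha - 1) * dot lambdas (A *m y k.+1 - b).
  by rewrite -!dotZr fpd_residual_y// dotDr dotNr.
(* The multiplier increment is parallel to the residual of [y], so this product absorbs the
   constraint terms left by [res] and [vE]. *)
have ll : dot (lambda k.+1 - lambdas) (lambda k.+1 - lambda k)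
    = k%:R * beta k * (dot (lambda k.+1) (A *m y k.+1 - b) - dot lambdas (A *m y k.+1 - b)).
  have -> : lambda k.+1 - lambda k = (k%:R * beta k) *: (A *m y k.+1 - b).
    by rewrite {1}(fpd_lambda halg)// addrC addKr.
  by rewrite dotZr dotDl dotNl.
have vE : k%:R * beta k * dot v (y k.+1 - xs) = k%:R * dot (eps k) (y k.+1 - xs)
    - (alpha - 1) * dot (y k.+1 - y k) (y k.+1 - xs)
    - k%:R * beta k * dot (lambda k.+1) (A *m y k.+1 - b).
  rewrite /v -Axs -mulmxBr !(dotNl, dotDl _ _ (y k.+1 - xs), dotZl) dot_trmx.
  by field; rewrite !gt_eqF.
rewrite ll.
have -> : (alpha - 1) * (k%:R * dot (eps k) (y k.+1 - xs)
       - (alpha - 1) * dot (y k.+1 - y k) (y k.+1 - xs)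
       - k%:R * beta k * (dot (lambda k.+1) (A *m y k.+1 - b) - dot lambdas (A *m y k.+1 - b)))
   = k%:R * beta k * ((alpha - 1) * dot v (y k.+1 - xs)
       + (alpha - 1) * dot lambdas (A *m y k.+1 - b)).
  rewrite [RHS]mulrDr !(mulrCA (k%:R * beta k) (alpha - 1)) vE; ring.
rewrite ler_pM2l ?mulr_gt0// dv -res /gap.
have a1 : 0 <= alpha - 1 by rewrite subr_ge0 ltW.
move: (ler_wpM2l kt hx)
  (ler_wpM2l a1 hs); lra.
Qed.

(** Expanding the squared distances at [k] around those at [k + 1] turns the inner products of
    [gap_step] into energy differences; the leftover squared increments have the favourable sign and
    are dropped. *)
Lemma energy_step k : (2 <= k)%N -> 0 <= k%:R + 1 - theta ->
  weight k.+1 = k%:R * (k%:R + alpha - theta) * beta k ->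
  energy k.+1 <= energy k + (alpha - 1) * (k%:R * dot (eps k) (y k.+1 - xs)).
Proof.
move=> k2 kt wE; have := gap_step k k2 kt.
rewrite /energy wE /weight.
have p0 : 0 < alpha - 1 by rewrite subr_gt0.
have := dot_ge0 (y k.+1 - y k); have := dot_ge0 (lambda k.+1 - lambda k).
have -> : y k - xs = (y k.+1 - xs) - (y k.+1 - y k) by apply/colP => i; rewrite !mxE; ring.
have -> : lambda k - lambdas = (lambda k.+1 - lambdas) - (lambda k.+1 - lambda k).
  by apply/colP => i; rewrite !mxE; ring.
move: (y k.+1 - y k) (y k.+1 - xs) (lambda k.+1 - lambda k) (lambda k.+1 - lambdas) => dy u dl l.
rewrite !dot_linear (dotC u dy) (dotC l dl) => dl0 dy0.
have := mulr_ge0 (ltW p0) dl0; have := mulr_ge0 (sqr_ge0 (alpha - 1)) dy0; lra.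
Qed.

End Energy.

(** In [fpd_residual_y] times [k beta_k], the two coefficients on the right become consecutive
    weights, and the left side becomes [alpha - 1] times the multiplier increment. *)
Lemma residual_step k : (1 <= k)%N ->
  weight k.+1 = k%:R * (k%:R + alpha - theta) * beta k ->
  weight k.+1 *: (A *m x k.+1 - b) - (alpha - 1) *: lambda k.+1
  = weight k *: (A *m x k - b) - (alpha - 1) *: lambda k.
Proof.
move=> k1 wE; have := fpd_residual_y k k1; rewrite (fpd_lambda halg)// wE /weight.
move: (A *m y k.+1 - b) (A *m x k.+1 - b) (A *m x k - b) => v u u' /colP vE.
apply/colP => i; have := vE i; rewrite !mxE => h.
by rewrite [_ * (lambda k i 0 + _)]mulrDr (mulrCA (alpha - 1)) h; ring.
Qed.

End Iteration.

(** * Bounded energy, bounded multipliers and the convergence rates *)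

Theorem corollary1 (R : realType) (m n : nat)
  (f : 'cV[R]_n -> \bar R) (A : 'M[R]_(m, n)) (b : 'cV[R]_m)
  (f_proper : proper_fun f)
  (f_lsc : lower_semicontinuous f)
  (f_convex : convex_efun f)
  (xs : 'cV[R]_n) (lambdas : 'cV[R]_m)
  (hKKT : KKT f A b (xs, lambdas))
  (alpha theta : R) (alpha_gt1 : 1 < alpha)
  (beta : nat -> R) (beta_gt0 : forall k, (1 <= k)%N -> 0 < beta k)
  (eps : nat -> 'cV[R]_n)
  (x y : nat -> 'cV[R]_n) (lambda : nat -> 'cV[R]_m)
  (halg : fast_primal_dual f A b alpha theta beta eps x y lambda)
  (hbeta : exists k1 : nat, [/\ (2 <= k1)%N, theta <= k1%:R &
     forall k, (k1 - 1 <= k)%N ->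
       beta k.+1 = k%:R * (k%:R + alpha - theta)
                   / ((k%:R + 1) * (k%:R + 2 - theta)) * beta k])
  (heps : (\sum_(1 <= k <oo) (k%:R * enorm (eps k))%:E < +oo)%E)
  (hlim : (fun k : nat => k%:R ^+ 2 * beta k) @ \oo --> +oo) :
  (fun k : nat => enorm (A *m x k - b)) =O_\oo
    (fun k : nat => 1 / (k%:R `^ (alpha - 1)))
  /\ (\forall k \near \oo, f (x k) \is a fin_num)
  /\ (fun k : nat => `|fine (f (x k)) - fine (f xs)|) =O_\oo
       (fun k : nat => 1 / (k%:R `^ (alpha - 1))).
Proof.
have [K [K2 thetaK betaE]] := hbeta.
have p0 : 0 < alpha - 1 by rewrite subr_gt0.
have kK k : (K <= k)%N -> K%:R <= k%:R :> R by rewrite ler_nat.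
have kt k : (K <= k)%N -> 0 < k%:R + 1 - theta by move=> /kK; lra.
have ge2 k : (K <= k)%N -> (2 <= k)%N by exact: leq_trans.
have k0 k : (K <= k)%N -> 0 < k%:R :> R by move=> /ge2/ltnW; rewrite ltr0n.
have b0 k : (K <= k)%N -> 0 < beta k by move=> /ge2/ltnW/beta_gt0.
pose w := @weight R theta beta.
have w_gt0 k : (K <= k)%N -> 0 < w k by move=> Kk; rewrite !mulr_gt0 ?k0 ?kt ?b0.
have wS k : (K <= k)%N -> w k.+1 = k%:R * (k%:R + alpha - theta) * beta k.
  move=> Kk; rewrite /w /weight betaE ?(leq_trans (leq_subr _ _))//.
  have := kt _ Kk; have := k0 _ Kk => h1 h2.
  by rewrite -natr1; field; rewrite !gt_eqF//; lra.
have [c c0 cw] : exists2 c, 0 < c & \forall k \near \oo, c * k%:R `^ (alpha - 1) <= w k.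
  (* Here [a - p = 1 - theta], so the ratio of consecutive weights has the form
     [(k + a) / (k + a - p)]. *)
  apply: (powR_growth w (alpha - theta) (alpha - 1) K) => //.
  - by have := kt _ (leqnn K); lra.
  - exact: w_gt0.
  move=> k Kk; rewrite wS// /w /weight; have := kt _ Kk => h.
  by field; rewrite gt_eqF//; lra.
pose E := @energy R m n f A b alpha theta beta x y lambda xs lambdas.
pose G := @gap R m n f A b x xs lambdas.
have G0 k : (K <= k)%N -> 0 <= G k by move=> /ge2; exact: (gap_ge0 halg f_proper hKKT).
have wG0 k : (K <= k)%N -> 0 <= w k * G k.
  by move=> Kk; rewrite mulr_ge0 ?G0// ltW// w_gt0.
have Ey0 k : 0 <= (alpha - 1) ^+ 2 / 2 * dot (y k - xs) (y k - xs).
  by rewrite mulr_ge0 ?dot_ge0 ?divr_ge0 ?sqr_ge0.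
have El0 k : 0 <= (alpha - 1) / 2 * dot (lambda k - lambdas) (lambda k - lambdas).
  by rewrite mulr_ge0 ?dot_ge0 ?divr_ge0 ?ltW.
have EE k : E k = w k * G k + (alpha - 1) ^+ 2 / 2 * dot (y k - xs) (y k - xs)
  + (alpha - 1) / 2 * dot (lambda k - lambdas) (lambda k - lambdas) by [].
have E_step k : (K <= k)%N ->
    E k.+1 <= E k + Num.sqrt 2 * (k%:R * enorm (eps k)) * Num.sqrt (E k.+1).
  move=> Kk.
  have := energy_step halg f_proper f_convex alpha_gt1 beta_gt0 hKKT k
    (ge2 _ Kk) (ltW (kt _ Kk)) (wS _ Kk).
  move/le_trans; apply; rewrite lerD2l.
  (* The constant [sqrt 2] undoes the factor 1/2 of the [y] term, which is at most the whole
     energy. *)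
  have y_le : (alpha - 1) * enorm (y k.+1 - xs) <= Num.sqrt 2 * Num.sqrt (E k.+1).
    rewrite -sqrtrM// -[leLHS]ger0_norm ?mulr_ge0 ?enorm_ge0 ?(ltW p0)// -sqrtr_sqr.
    rewrite ler_wsqrtr// exprMn sqr_enorm.
    have := wG0 _ (leqW Kk); have := El0 k.+1; rewrite EE; lra.
  have := le_trans (ler_norm _) (cauchy_schwarz (eps k) (y k.+1 - xs)) => eps_le.
  rewrite mulrCA [leRHS]mulrAC [leRHS]mulrC -[leRHS]mulrA ler_pM2l ?k0//.
  apply: (le_trans (ler_wpM2l (ltW p0) eps_le)).
  by rewrite mulrCA ler_wpM2l ?enorm_ge0.
have eps0 k : 0 <= k%:R * enorm (eps k) by rewrite mulr_ge0 ?enorm_ge0.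
have [S S_sum] := nneseries_partial_bounded _ eps0 heps.
have [M EM] : exists M, forall k, (K <= k)%N -> E k <= M.
  exists ((Num.sqrt (E K) + Num.sqrt 2 * S) ^+ 2) => k.
  apply: (sqrt_recurrence_bounded E _ K _ _ _ E_step) => j Kj.
  - by rewrite EE !addr_ge0 ?wG0.
  - by rewrite mulr_ge0 ?sqrtr_ge0.
  - by rewrite -mulr_sumr ler_wpM2l ?sqrtr_ge0// S_sum// ltnW// ge2.
have wG_le k : (K <= k)%N -> w k * G k <= M.
  by move=> Kk; have := EM k Kk; have := Ey0 k; have := El0 k; rewrite EE; lra.
have M0 : 0 <= M by exact: le_trans (wG0 _ (leqnn K)) (wG_le _ (leqnn K)).
(* Solves [(alpha - 1) / 2 * L^2 = M], since the multiplier term alone is at most [M]. *)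
pose L := Num.sqrt (2 * M / (alpha - 1)).
have lambda_le k : (K <= k)%N -> enorm (lambda k - lambdas) <= L.
  move=> Kk; apply: enorm_le; rewrite ?sqrtr_ge0// sqr_sqrtr; last first.
    by rewrite divr_ge0 ?mulr_ge0 ?(ltW p0).
  rewrite ler_pdivlMr//.
  by have := EM k Kk; have := Ey0 k; have := wG0 k Kk; rewrite EE; lra.
pose z := w K *: (A *m x K - b) - (alpha - 1) *: lambda K.
have wr k : (K <= k)%N -> w k *: (A *m x k - b) - (alpha - 1) *: lambda k = z.
  elim: k => [/ge2 //|k IH].
  rewrite leq_eqVlt => /predU1P[<- //|]; rewrite ltnS => Kk.
  by rewrite (residual_step halg alpha_gt1 k (ltnW (ge2 _ Kk)) (wS _ Kk)) IH.
(* The invariant [z] gives the weighted residual as [z + (alpha - 1) lambda_k]; splitting [lambda_k]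
   around [lambdas] yields this bound. *)
pose C := enorm (z + (alpha - 1) *: lambdas) + (alpha - 1) * L.
have C0 : 0 <= C by rewrite addr_ge0 ?enorm_ge0// mulr_ge0 ?sqrtr_ge0// ltW.
have r_le k : (K <= k)%N -> w k * enorm (A *m x k - b) <= C.
  move=> Kk; rewrite -[w k]gtr0_norm ?w_gt0// -enormZ.
  have -> : w k *: (A *m x k - b)
      = z + (alpha - 1) *: lambdas + (alpha - 1) *: (lambda k - lambdas).
    by rewrite -(wr k Kk) (scalerBr _ (lambda k)) -addrA subrKC subrK.
  apply: (le_trans (enormD _ _)); rewrite enormZ gtr0_norm// lerD2l.
  by rewrite ler_pM2l// lambda_le.
split; [|split].
- apply: (eqO_inv_powR _ w _ c C K) => // k Kk.
  by rewrite ger0_norm ?enorm_ge0// r_le.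
- exists K => // k /= Kk; exact: (fpd_fin_num halg f_proper k (ge2 _ Kk)).
- apply: (eqO_inv_powR _ w _ c (M + enorm lambdas * C) K) => //.
    by rewrite addr_ge0// mulr_ge0 ?enorm_ge0.
  move=> k Kk; rewrite normr_id.
  (* The objective error is the gap, of weighted size at most [M], minus a multiplier term bounded
     by Cauchy-Schwarz and [r_le]. *)
  have -> : fine (f (x k)) - fine (f xs) = G k - dot lambdas (A *m x k - b).
    by rewrite /G /gap addrK.
  apply: (le_trans (ler_wpM2l (ltW (w_gt0 _ Kk)) (ler_normB _ _))).
  rewrite (ger0_norm (G0 _ Kk)) mulrDr lerD ?wG_le//.
  apply: (le_trans (ler_wpM2l (ltW (w_gt0 _ Kk)) (cauchy_schwarz _ _))).
  by rewrite mulrCA ler_wpM2l ?enorm_ge0// r_le.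
Qed.
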